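(* There is a constant $C>0$ such that for all $q,\bar q\in\mathbf{Q}$, $$\left|\,\lambda(q)-\lambda(\bar q)-\int_0^1\bigl(q(x)-\bar q(x)\bigr)\,u_{\bar q}^2(x)\,dx\,\right|\;\le\; C\,\|q-\bar q\|_\infty^2 ,$$ that is, $\lambda(q)=\lambda(\bar q)+\int_0^1(q(x)-\bar q(x))u_{\bar q}^2(x)\,dx+O(\|q-\bar q\|_\infty^2)$ with the factor in the big-$O$ notation independent of $q$ and $\bar q$.
   Context: $\mathbf{Q}$ is the class of functions $q:[0,1]\to[0,1]$ with $q\in C^2([0,1])$ and $\max_{i=0,1,2}\max_{x\in[0,1]}|q^{(i)}(x)|\le 1$. For $q\in\mathbf{Q}$, $\lambda(q)$ denotes the smallest eigenvalue of the Sturm-Liouville problem $-u''(x)+q(x)u(x)=\lambda u(x)$ for $x\in(0,1)$, $u(0)=u(1)=0$. $u_q$ denotes a real eigenfunction corresponding to $\lambda(q)$, normalized by $\int_0^1u_q^2(x)\,dx=1$; it is unique up to sign, so $u_q^2$ is uniquely defined. $\|f\|_\infty=\max_{x\in[0,1]}|f(x)|$. *)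

(* Defs.v *)
From Stdlib Require Import Reals ClassicalEpsilon.
From Coquelicot Require Import Coquelicot.

Open Scope R_scope.

(* Functions on [0,1] are represented by functions R -> R; every notion below
   depends only on their values on [0,1].  At the endpoints, derivatives and
   continuity are relative to [0,1], i.e. one-sided. *)

Definition I01 (x : R) : Prop := 0 <= x <= 1.

(* f is C^2 on [0,1], with f' = f1 and f'' = f2 there.  Continuity of f and f1
   follows from their differentiability. *)
Definition C2_with (f f1 f2 : R -> R) : Prop :=
  forall x, I01 x ->
    D_in f f1 I01 x /\ D_in f1 f2 I01 x /\ continue_in f2 I01 x.

(* For f continuous on [0,1] the supremum is finite and attained, so this is
   max_{[0,1]} |f|.  (For an unbounded f it is the junk value 0; it is only
   applied to continuous functions.) *)
Definition norm_inf (f : R -> R) : R :=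
  real (Lub_Rbar (fun y => exists x, I01 x /\ y = Rabs (f x))).

Definition classQ (q : R -> R) : Prop :=
  (forall x, I01 x -> I01 (q x)) /\
  exists q1 q2 : R -> R,
    C2_with q q1 q2 /\
    Rmax (norm_inf q) (Rmax (norm_inf q1) (norm_inf q2)) <= 1.

(* u is a (classical, real) eigenfunction of -u'' + q u = l u on (0,1),
   u(0) = u(1) = 0. *)
Definition is_eigenfunction (q : R -> R) (l : R) (u : R -> R) : Prop :=
  (exists u1 u2 : R -> R,
     C2_with u u1 u2 /\
     forall x, 0 < x < 1 -> - u2 x + q x * u x = l * u x) /\
  u 0 = 0 /\ u 1 = 0 /\
  exists x, I01 x /\ u x <> 0.

Definition is_eigenvalue (q : R -> R) (l : R) : Prop :=
  exists u, is_eigenfunction q l u.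

Definition is_smallest_eigenvalue (q : R -> R) (l : R) : Prop :=
  is_eigenvalue q l /\ forall m, is_eigenvalue q m -> l <= m.

(* The smallest eigenvalue (arbitrary if there were none). *)
Definition lambda (q : R -> R) : R :=
  epsilon (inhabits 0) (is_smallest_eigenvalue q).

Definition is_normalized_ground_state (q u : R -> R) : Prop :=
  is_eigenfunction q (lambda q) u /\ RInt (fun x => u x ^ 2) 0 1 = 1.

(* Main.v *)
Require Import Defs.
From Stdlib Require Import Reals Lra Lia ClassicalEpsilon.
From Coquelicot Require Import Coquelicot.

Open Scope R_scope.

(** For a bounded continuous potential p let phi_p solve y'' = p y, y(0) = 0, y'(0) = 1.
    The smallest eigenvalue l of q is the first l at which phi_(q-l) stops being positive
    on (0,1]; its ground state phi_(q-l) is positive on (0,1), and every eigenfunction is a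
    multiple of it. Write p = q - lambda(q), r = qbar - lambda(qbar), d = |q - qbar|_oo.
    Green's identity gives int (p - r) phi_p phi_r = 0. Positivity of both factors forces
    |lambda(q) - lambda(qbar)| <= d, so |p - r| <= 2 d, and Gronwall gives
    |phi_p - phi_r| <= C d. Since u = b phi_r with int u^2 = 1, subtracting Green's
    identity shows that
      lambda(q) - lambda(qbar) - int (q - qbar) u^2 = b^2 int (p - r) phi_r (phi_p - phi_r),
    a product of two factors of order d; b is bounded uniformly. *)

(** * Functions on [0,1] extended to the line *)

Definition clamp (x : R) : R := Rmax 0 (Rmin 1 x).

Lemma clamp_I01 (x : R) : I01 (clamp x).
Proof. unfold I01, clamp, Rmax, Rmin; repeat destruct Rle_dec; lra. Qed.

Lemma clamp_id (x : R) : I01 x -> clamp x = x.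
Proof. unfold I01, clamp, Rmax, Rmin; repeat destruct Rle_dec; lra. Qed.

Lemma clamp_lipschitz (x y : R) : Rabs (clamp x - clamp y) <= Rabs (x - y).
Proof.
unfold clamp, Rmax, Rmin, Rabs; repeat destruct Rle_dec; repeat destruct Rcase_abs; lra.
Qed.

(** Constant continuation past the endpoints turns one-sided continuity on [0,1] into continuity on
    the line, so the initial value problem can be posed on all of R. *)
Definition ext (f : R -> R) (x : R) : R := f (clamp x).

Lemma continuous_ext01 (f : R -> R) :
  (forall x, I01 x -> continue_in f I01 x) -> forall x, continuous (ext f) x.
Proof.
intros Hf x; apply continuity_pt_filterlim; intros eps Heps.
destruct (Hf _ (clamp_I01 x) eps Heps) as [a [Ha H]].
exists a; split; [exact Ha|]; intros y [_ Hy]; simpl in *; unfold ext, Rdist in *.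
(* [continue_in] only tests points different from the base point, so points clamped to the same
   value are treated apart. *)
destruct (Req_dec (clamp x) (clamp y)) as [E|E].
- rewrite E, Rminus_diag, Rabs_R0; exact Heps.
- apply H; repeat split; try apply clamp_I01; try exact E.
  apply Rle_lt_trans with (2 := Hy), clamp_lipschitz.
Qed.

Lemma continue_in_continuous (f : R -> R) (D : R -> Prop) (x : R) :
  continuous f x -> continue_in f D x.
Proof.
intros H; apply continuity_pt_filterlim in H; intros eps Heps.
destruct (H eps Heps) as [a [Ha H']]; exists a; split; [exact Ha|].
intros y [[_ Hxy] Hy]; apply H'; repeat split; assumption.
Qed.

Lemma D_in_is_derive (f df : R -> R) (D : R -> Prop) (x : R) :
  is_derive f x (df x) -> D_in f df D x.
Proof.
intros H; apply is_derive_Reals in H; intros eps Heps.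
destruct (H eps Heps) as [d Hd]; exists d; split; [apply cond_pos|].
intros y [[_ Hxy] Hy]; simpl in *; unfold Rdist in *.
specialize (Hd (y - x)); replace (x + (y - x)) with y in Hd by ring.
apply Hd; [lra|exact Hy].
Qed.

Lemma is_derive_D_in (f df : R -> R) (x : R) :
  0 < x < 1 -> D_in f df I01 x -> is_derive f x (df x).
Proof.
intros Hx H; apply is_derive_Reals; intros eps Heps.
destruct (H eps Heps) as [a [Ha H']].
(* This radius keeps [x + h] inside [0,1], where [D_in] gives information. *)
assert (Hm : 0 < Rmin a (Rmin x (1 - x))) by (repeat apply Rmin_pos; lra).
exists (mkposreal _ Hm); intros h Hh; simpl; intros Hlt.
pose proof (Rmin_l a (Rmin x (1 - x))); pose proof (Rmin_r a (Rmin x (1 - x))).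
pose proof (Rmin_l x (1 - x)); pose proof (Rmin_r x (1 - x)).
specialize (H' (x + h)); simpl in H'; unfold Rdist, D_x, I01 in H'.
replace (x + h - x) with h in H' by ring.
apply H'; destruct (Rabs_def2 h (Rmin a (Rmin x (1 - x))) Hlt).
repeat split; lra.
Qed.

(** * Monotonicity and Gronwall's inequality *)

Lemma nonincreasing_le (F dF : R -> R) (a b : R) :
  a <= b ->
  (forall x, a <= x <= b -> continuous F x) ->
  (forall x, a < x < b -> is_derive F x (dF x) /\ dF x <= 0) ->
  F b <= F a.
Proof.
intros Hab Hc Hd.
(* [MVT_gen] may return an endpoint, where nothing is known about [dF]. *)
destruct (MVT_gen F a b (fun x => if excluded_middle_informative (a < x < b) then dF x else 0))
  as [c [Hc1 Hc2]].
- rewrite Rmin_left, Rmax_right by lra; intros t Ht.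
  destruct excluded_middle_informative; [now apply Hd|contradiction].
- rewrite Rmin_left, Rmax_right by lra; intros t Ht; apply continuity_pt_filterlim, Hc, Ht.
- destruct excluded_middle_informative as [H|H]; [destruct (Hd c H)|]; nra.
Qed.

(** The integrating factor exp(-K x) makes F nonincreasing. Derivatives are asked for only in the
    interior because eigenfunctions have one-sided derivatives at 0 and 1. F may be negative: a
    negated energy yields a lower bound. *)
Lemma gronwall (F dF : R -> R) (K : R) :
  (forall x, 0 <= x <= 1 -> continuous F x) ->
  (forall x, 0 < x < 1 -> is_derive F x (dF x) /\ dF x <= K * F x) ->
  forall x, 0 <= x <= 1 -> F x <= F 0 * exp (K * x).
Proof.
intros Hc Hd x Hx.
assert (Hle : F x * exp (- K * x) <= F 0 * exp (- K * 0)).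
{ apply (nonincreasing_le (fun t => F t * exp (- K * t))
    (fun t => dF t * exp (- K * t) + F t * (- K * exp (- K * t)))); [lra| |].
  - intros t Ht; apply (continuous_mult F (fun t => exp (- K * t))); [apply Hc; lra|].
    apply (ex_derive_continuous (V := R_NormedModule)); auto_derive; trivial.
  - intros t Ht; destruct (Hd t) as [Hd1 Hd2]; [lra|]; split.
    + apply (is_derive_mult F (fun t => exp (- K * t))); [exact Hd1| |intros; apply Rmult_comm].
      auto_derive; [trivial|ring].
    + pose proof (exp_pos (- K * t)); nra. }
rewrite Rmult_0_r, exp_0, Rmult_1_r in Hle.
replace (F x) with (F x * exp (- K * x) * exp (K * x)).
- apply Rmult_le_compat_r; [apply Rlt_le, exp_pos|exact Hle].
- rewrite Rmult_assoc, <- exp_plus; replace (- K * x + K * x) with 0 by ring.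
  rewrite exp_0; ring.
Qed.

(** * The initial value problem *)

(** The terms after index n are dominated by A 2^-(n+1) + A 2^-(n+2) + ... = A 2^-n. *)
Lemma geometric_tail (a : nat -> R) (A : R) :
  (forall n, Rabs (a n) <= A * (/ 2) ^ n) ->
  ex_series a /\ forall n, Rabs (Series a - sum_n a n) <= A * (/ 2) ^ n.
Proof.
intros Ha.
assert (Hg : ex_series (fun n => (/ 2) ^ n)) by (apply ex_series_geom; rewrite Rabs_right; lra).
assert (He : forall k, ex_series (fun n => Rabs (a (k + n)%nat))).
{ intros k; apply (ex_series_le (K := R_AbsRing) (V := R_CompleteNormedModule)) with (b := fun n => (A * (/ 2) ^ k) * (/ 2) ^ n).
  - intros n; unfold norm; simpl; unfold abs; simpl; rewrite Rabs_Rabsolu.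
    rewrite Rmult_assoc, <- pow_add; apply Ha.
  - now apply (ex_series_scal_l (K := R_AbsRing) (V := R_NormedModule)). }
assert (Hs : ex_series a) by (apply ex_series_Rabs, (He O)).
split; [exact Hs|]; intros n.
rewrite (Series_incr_n a (S n)) by (lia || exact Hs).
simpl Init.Nat.pred; rewrite <- sum_n_Reals.
match goal with |- Rabs ?t <= _ =>
  replace t with (Series (fun k => a (S n + k)%nat)) by (simpl; ring) end.
apply Rle_trans with (1 := Series_Rabs _ (He (S n))).
apply Rle_trans with (Series (fun k => (A * (/ 2) ^ S n) * (/ 2) ^ k)).
- apply Series_le; [|now apply (ex_series_scal_l (K := R_AbsRing) (V := R_NormedModule))].
  intros k; split; [apply Rabs_pos|]; rewrite Rmult_assoc, <- pow_add; apply Ha.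
- rewrite Series_scal_l, Series_geom by (rewrite Rabs_right; lra).
  right; simpl; field.
Qed.

(** By [geometric_tail] the sums of derivatives converge uniformly on the ball and the sums of
    functions converge pointwise, which allows limit and derivative to be exchanged. *)
Lemma is_derive_Series (a b : nat -> R -> R) (r A x : R) :
  Rabs x < r ->
  (forall n y, Rabs y < r -> is_derive (a n) y (b n y) /\
    Rabs (a n y) <= A * (/ 2) ^ n /\ Rabs (b n y) <= A * (/ 2) ^ n) ->
  is_derive (fun y => Series (fun n => a n y)) x (Series (fun n => b n x)).
Proof.
intros Hx H.
assert (Hr : 0 < r) by (pose proof (Rabs_pos x); lra).
assert (HB : forall y, Boule 0 (mkposreal r Hr) y <-> Rabs y < r)
  by (intros y; unfold Boule; simpl; rewrite Rminus_0_r; tauto).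
assert (Hlim : is_lim_seq (fun n => A * (/ 2) ^ n) 0).
{ replace 0 with (A * 0) by ring; apply is_lim_seq_mult'; [apply is_lim_seq_const|].
  apply is_lim_seq_geom; rewrite Rabs_right; lra. }
apply is_derive_Reals.
apply (CVU_derivable (fun N y => sum_n (fun n => a n y) N) (fun N y => sum_n (fun n => b n y) N)
  _ (fun y => Series (fun n => b n y)) 0 (mkposreal r Hr)).
- intros eps Heps; apply is_lim_seq_Reals in Hlim; destruct (Hlim eps Heps) as [N HN].
  exists N; intros n y Hn Hy; apply (proj1 (HB y)) in Hy.
  apply Rle_lt_trans with (A * (/ 2) ^ n).
  + apply (geometric_tail (fun n => b n y)); intros k; exact (proj2 (proj2 (H k y Hy))).
  + specialize (HN n Hn); unfold Rdist in HN; rewrite Rminus_0_r in HN.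
    apply Rle_lt_trans with (2 := HN), Rle_abs.
- intros y Hy; apply (proj1 (HB y)) in Hy; apply is_lim_seq_Reals.
  apply (Series_correct (fun n => a n y)), (geometric_tail _ A); intros k.
  exact (proj1 (proj2 (H k y Hy))).
- intros N y Hy; apply (proj1 (HB y)) in Hy; apply is_derive_Reals, (is_derive_sum_n a N y (fun n => b n y)).
  intros k _; exact (proj1 (H k y Hy)).
- now apply HB.
Qed.

Lemma ex_RInt_cont (f : R -> R) (a b : R) : (forall x, continuous f x) -> ex_RInt f a b.
Proof. intros Hf; apply (ex_RInt_continuous (V := R_CompleteNormedModule)); intros; apply Hf. Qed.

Lemma is_derive_RInt_0 (f : R -> R) (x : R) :
  (forall t, continuous f t) -> is_derive (fun y => RInt f 0 y) x (f x).
Proof.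
intros Hf; apply (is_derive_RInt f _ 0 x); [|apply Hf].
apply filter_forall; intros y; apply (RInt_correct (V := R_CompleteNormedModule)).
apply ex_RInt_cont, Hf.
Qed.

Lemma continuous_sqr (f : R -> R) (x : R) :
  continuous f x -> continuous (fun t => f t ^ 2) x.
Proof.
intros Hf; apply continuous_ext with (fun t => f t * f t); [intros t; simpl; ring|].
now apply (continuous_mult f f).
Qed.

Lemma is_derive_continuous (f : R -> R) (x l : R) : is_derive f x l -> continuous f x.
Proof. intros H; apply (ex_derive_continuous (V := R_NormedModule)); now exists l. Qed.

(** These are the increments of Picard iteration rather than the iterates: each has second
    derivative p times its predecessor, so their sum formally solves y'' = p y, y(0) = 0, y'(0) =
    1. *)
Fixpoint picard (p : R -> R) (n : nat) (x : R) : R :=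
  match n with
  | O => x
  | S n => RInt (fun s => RInt (fun t => p t * picard p n t) 0 s) 0 x
  end.

Definition picard1 (p : R -> R) (n : nat) (x : R) : R :=
  match n with O => 1 | S n => RInt (fun t => p t * picard p n t) 0 x end.

Definition picard2 (p : R -> R) (n : nat) (x : R) : R :=
  match n with O => 0 | S n => p x * picard p n x end.

Definition phi (p : R -> R) (x : R) : R := Series (fun n => picard p n x).
Definition phi1 (p : R -> R) (x : R) : R := Series (fun n => picard1 p n x).

Lemma picard_derive (p : R -> R) (n : nat) (x : R) :
  (forall t, continuous p t) ->
  is_derive (picard p n) x (picard1 p n x) /\ is_derive (picard1 p n) x (picard2 p n x).
Proof.
intros Hp; revert x; induction n as [|n IH]; intros x.
- split; simpl; [apply (is_derive_id x)|apply (is_derive_const 1 x)].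
- assert (H1 : forall y, is_derive (picard1 p (S n)) y (picard2 p (S n) y)).
  { intros y; apply (is_derive_RInt_0 (fun t => p t * picard p n t)); intros t.
    apply (continuous_mult p); [apply Hp|exact (is_derive_continuous _ _ _ (proj1 (IH t)))]. }
  split; [|apply H1].
  apply (is_derive_RInt_0 (picard1 p (S n))); intros t; eapply is_derive_continuous, H1.
Qed.

(** Integrating the bound on F' gives (c / K) (exp(K x) - 1). Measured against the weight exp(K x),
    one integration gains a factor 1 / K. *)
Lemma exp_weight_bound_pos (F dF : R -> R) (c K : R) :
  0 < K -> F 0 = 0 ->
  (forall x, is_derive F x (dF x) /\ Rabs (dF x) <= c * exp (K * Rabs x)) ->
  forall x, 0 <= x -> F x <= c / K * exp (K * x).
Proof.
intros HK H0 H x Hx.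
assert (Hc : 0 <= c).
{ destruct (H 0) as [_ H']; rewrite Rabs_R0, Rmult_0_r, exp_0 in H'.
  pose proof (Rabs_pos (dF 0)); lra. }
assert (Hle : F x - c / K * exp (K * x) <= F 0 - c / K * exp (K * 0)).
{ assert (Hd : forall y, is_derive (fun t => F t - c / K * exp (K * t)) y (dF y - c * exp (K * y))).
  { intros y; apply (is_derive_minus F (fun t => c / K * exp (K * t))); [apply H|].
    auto_derive; [trivial|field; lra]. }
  apply (nonincreasing_le (fun t => F t - c / K * exp (K * t)) (fun y => dF y - c * exp (K * y))); [exact Hx| |].
  - intros y _; eapply is_derive_continuous, Hd.
  - intros y Hy; split; [apply Hd|].
    destruct (H y) as [_ H']; rewrite (Rabs_right y) in H' by lra.
    pose proof (Rle_abs (dF y)); lra. }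
rewrite H0, Rmult_0_r, exp_0 in Hle.
assert (0 <= c / K) by (apply Rdiv_le_0_compat; assumption); lra.
Qed.

(** Two symmetries reduce this to the one-sided bound: negating F gives the absolute value, and
    reflecting t to -t gives the negative half-line. *)
Lemma exp_weight_bound (F dF : R -> R) (c K : R) :
  0 < K -> F 0 = 0 ->
  (forall x, is_derive F x (dF x) /\ Rabs (dF x) <= c * exp (K * Rabs x)) ->
  forall x, Rabs (F x) <= c / K * exp (K * Rabs x).
Proof.
intros HK H0 H.
assert (Hopp : forall G dG, G 0 = 0 ->
  (forall x, is_derive G x (dG x) /\ Rabs (dG x) <= c * exp (K * Rabs x)) ->
  forall x, 0 <= x -> Rabs (G x) <= c / K * exp (K * x)).
{ intros G dG G0 HG x Hx; apply Rabs_le; split.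
  - assert (- G x <= c / K * exp (K * x)); [|lra].
    apply (exp_weight_bound_pos (fun t => - G t) (fun t => - dG t)); try assumption; [lra|].
    intros y; destruct (HG y); split; [now apply (is_derive_opp G)|now rewrite Rabs_Ropp].
  - now apply (exp_weight_bound_pos G dG). }
intros x; destruct (Rle_or_lt 0 x) as [Hx|Hx].
- rewrite (Rabs_right x) by lra; now apply Hopp with dF.
- rewrite (Rabs_left x) by lra.
  replace x with (- - x) at 1 by ring.
  apply (Hopp (fun t => F (- t)) (fun t => - dF (- t))); [now rewrite Ropp_0| |lra].
  intros y; destruct (H (- y)) as [H1 H2]; rewrite Rabs_Ropp in H2; split.
  + evar_last; [apply (is_derive_comp F Ropp); [exact H1|]|].
    * instantiate (1 := -1); auto_derive; [trivial|ring].
    * unfold scal; simpl; unfold mult; simpl; ring.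
  + now rewrite Rabs_Ropp.
Qed.

(** With weight K = 2 M + 1, multiplying by p and integrating once costs M / K <= 1/2, and the
    second integration costs 1 / K <= 1. Hence the geometric decay on the whole line. *)
Lemma picard_bound (p : R -> R) (M : R) (n : nat) (x : R) :
  (forall t, continuous p t) -> (forall t, Rabs (p t) <= M) ->
  Rabs (picard p n x) <= (/ 2) ^ n * exp ((2 * M + 1) * Rabs x) /\
  Rabs (picard1 p n x) <= (/ 2) ^ n * exp ((2 * M + 1) * Rabs x).
Proof.
intros Hp HM.
assert (M0 : 0 <= M) by (pose proof (Rabs_pos (p 0)); specialize (HM 0); lra).
revert x; induction n as [|n IH]; intros x.
- simpl; rewrite Rmult_1_l, Rabs_R1.
  pose proof (exp_ineq1_le ((2 * M + 1) * Rabs x)); pose proof (Rabs_pos x); nra.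
- assert (H1 : forall y, Rabs (picard1 p (S n) y) <= (/ 2) ^ S n * exp ((2 * M + 1) * Rabs y)).
  { intros y.
    apply Rle_trans with ((M * (/ 2) ^ n) / (2 * M + 1) * exp ((2 * M + 1) * Rabs y)).
    - apply (exp_weight_bound _ (picard2 p (S n))); [lra|exact (RInt_point 0 (fun t => p t * picard p n t))|].
      intros z; split; [now apply picard_derive|].
      simpl; rewrite Rabs_mult, Rmult_assoc.
      apply Rmult_le_compat; try apply Rabs_pos; [apply HM|apply IH].
    - apply Rmult_le_compat_r; [apply Rlt_le, exp_pos|].
      assert (0 < (/ 2) ^ n) by (apply pow_lt; lra).
      simpl; apply Rmult_le_reg_r with (2 * M + 1); [lra|].
      unfold Rdiv; rewrite Rmult_assoc, Rinv_l by lra; nra. }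
  split; [|apply H1].
  apply Rle_trans with ((/ 2) ^ S n / (2 * M + 1) * exp ((2 * M + 1) * Rabs x)).
  + apply (exp_weight_bound _ (picard1 p (S n))); [lra|exact (RInt_point 0 (picard1 p (S n)))|].
    intros z; split; [now apply picard_derive|apply H1].
  + apply Rmult_le_compat_r; [apply Rlt_le, exp_pos|].
    assert (0 < (/ 2) ^ S n) by (apply pow_lt; lra).
    apply Rmult_le_reg_r with (2 * M + 1); [lra|].
    unfold Rdiv; rewrite Rmult_assoc, Rinv_l by lra; nra.
Qed.

(** The equation is imposed on the whole line, so derivatives are two-sided even at 0 and 1. *)
Definition solves (p y y1 : R -> R) : Prop :=
  y 0 = 0 /\ y1 0 = 1 /\
  forall x, is_derive y x (y1 x) /\ is_derive y1 x (p x * y x).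

Lemma phi_solves (p : R -> R) (M : R) :
  (forall t, continuous p t) -> (forall t, Rabs (p t) <= M) -> solves p (phi p) (phi1 p).
Proof.
intros Hp HM.
assert (M0 : 0 <= M) by (pose proof (Rabs_pos (p 0)); specialize (HM 0); lra).
assert (E0 : forall n, picard p n 0 = 0)
  by (intros [|n]; [reflexivity|exact (RInt_point 0 (picard1 p (S n)))]).
assert (E1 : forall n, picard1 p n 0 = match n with O => 1 | S _ => 0 end)
  by (intros [|n]; [reflexivity|exact (RInt_point 0 (fun t => p t * picard p n t))]).
assert (Z : Series (fun _ => 0) = 0) by (apply is_series_unique, filterlim_ext with (fun _ => 0);
   [intros n; rewrite sum_n_const; ring|apply filterlim_const]).
split; [|split].
- unfold phi; transitivity (Series (fun _ : nat => 0)); [apply Series_ext, E0|exact Z].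
- unfold phi1; rewrite Series_incr_1.
  + rewrite (Series_ext (fun k => picard1 p (S k) 0) (fun _ => 0)), Z by (intros n; apply E1).
    simpl; ring.
  + apply (geometric_tail _ 1); intros n; rewrite E1.
    assert (0 < (/ 2) ^ n) by (apply pow_lt; lra).
    destruct n; [simpl; rewrite Rabs_R1; lra|rewrite Rabs_R0; lra].
- intros x.
  set (r := Rabs x + 1); set (K := 2 * M + 1).
  (* The factor 2 M + 1 lets [A] majorise the second derivatives as well: up to the exponential,
     their term n + 1 is at most M 2^-n = 2 M 2^-(n+1). *)
  set (A := (2 * M + 1) * exp (K * r)).
  assert (Hb : forall n y, Rabs y < r -> Rabs (picard p n y) <= (/ 2) ^ n * exp (K * r) /\
                Rabs (picard1 p n y) <= (/ 2) ^ n * exp (K * r)).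
  { intros n y Hy.
    assert (Hexp : (/ 2) ^ n * exp (K * Rabs y) <= (/ 2) ^ n * exp (K * r)).
    { apply Rmult_le_compat_l; [apply pow_le; lra|].
      apply Rlt_le, exp_increasing, Rmult_lt_compat_l; [unfold K; lra|exact Hy]. }
    destruct (picard_bound p M n y Hp HM) as [B1 B2]; fold K in B1, B2; lra. }
  assert (HA : forall n, (/ 2) ^ n * exp (K * r) <= A * (/ 2) ^ n).
  { intros n; unfold A; assert (0 < (/ 2) ^ n) by (apply pow_lt; lra).
    pose proof (exp_pos (K * r)).
    assert (0 < (/ 2) ^ n * exp (K * r)) by now apply Rmult_lt_0_compat.
    replace ((2 * M + 1) * exp (K * r) * (/ 2) ^ n) with
      ((2 * M + 1) * ((/ 2) ^ n * exp (K * r))) by ring; nra. }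
  assert (Hr : Rabs x < r) by (unfold r; lra).
  split.
  + apply (is_derive_Series _ _ r A x Hr); intros n y Hy.
    destruct (Hb n y Hy); specialize (HA n); split; [now apply picard_derive|lra].
  + replace (p x * phi p x) with (Series (fun n => picard2 p n x)).
    * apply (is_derive_Series _ _ r A x Hr); intros n y Hy.
      split; [now apply picard_derive|]; split.
      { destruct (Hb n y Hy); specialize (HA n); lra. }
      destruct n as [|n]; simpl picard2.
      { rewrite Rabs_R0; simpl; pose proof (HA O); simpl in *; pose proof (exp_pos (K * r)); lra. }
      rewrite Rabs_mult; destruct (Hb n y Hy) as [B _].
      apply Rle_trans with (M * ((/ 2) ^ n * exp (K * r))).
      { apply Rmult_le_compat; try apply Rabs_pos; [apply HM|exact B]. }
      unfold A; simpl; assert (0 < (/ 2) ^ n) by (apply pow_lt; lra).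
      pose proof (exp_pos (K * r)).
      assert (0 < (/ 2) ^ n * exp (K * r)) by now apply Rmult_lt_0_compat.
      nra.
    (* The zeroth second derivative is 0; dropping it shifts the series to that of
       [p x * picard p n x]. *)
    * rewrite Series_incr_1_aux by reflexivity.
      unfold phi; rewrite <- Series_scal_l; reflexivity.
Qed.

(** * Energy estimates and positivity of solutions *)

Lemma exp_nondecreasing (x y : R) : x <= y -> exp x <= exp y.
Proof. intros [H|H]; [now apply Rlt_le, exp_increasing|rewrite H; apply Rle_refl]. Qed.

Lemma nondecreasing_le (F dF : R -> R) (a b : R) :
  a <= b -> (forall x, is_derive F x (dF x)) -> (forall x, a < x < b -> 0 <= dF x) ->
  F a <= F b.
Proof.
intros Hab Hd Hp.
assert (- F b <= - F a); [|lra].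
apply (nonincreasing_le (fun t => - F t) (fun t => - dF t)); [exact Hab| |].
- intros x _; apply (is_derive_continuous _ _ (- dF x)), (is_derive_opp F), Hd.
- intros x Hx; split; [apply (is_derive_opp F), Hd|specialize (Hp x Hx); lra].
Qed.

(** The energy E = y^2 + y'^2 satisfies E' = 2 (1 + p) y y', hence |E'| <= (1 + M) E, and Gronwall
    applies to E and to -E. *)
Lemma energy_bounds (p y y1 : R -> R) (M : R) :
  solves p y y1 -> (forall x, 0 <= x <= 1 -> Rabs (p x) <= M) ->
  forall x, 0 <= x <= 1 ->
    exp (- (1 + M) * x) <= y x ^ 2 + y1 x ^ 2 <= exp ((1 + M) * x).
Proof.
intros (H0 & H1 & Hd) HM x Hx.
set (dE := fun t => 2 * y t * y1 t + 2 * y1 t * (p t * y t)).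
assert (HdE : forall t, is_derive (fun t => y t ^ 2 + y1 t ^ 2) t (dE t)).
{ intros t; destruct (Hd t) as [D1 D2].
  evar_last; [apply (is_derive_plus (fun t => y t ^ 2) (fun t => y1 t ^ 2));
    [apply is_derive_pow, D1|apply is_derive_pow, D2]|].
  unfold dE, plus; simpl; ring. }
assert (Hb : forall t, 0 < t < 1 -> - ((1 + M) * (y t ^ 2 + y1 t ^ 2)) <= dE t
                                  <= (1 + M) * (y t ^ 2 + y1 t ^ 2)).
{ intros t Ht; unfold dE.
  assert (Hp : - M <= p t <= M) by (apply Rabs_le_between, HM; lra).
  (* [A1] plus [A4] expands to the lower bound, [A2] plus [A3] to the upper one. *)
  assert (A1 : 0 <= (1 + p t + (1 + M)) * (y t + y1 t) ^ 2)
    by (apply Rmult_le_pos; [lra|apply pow2_ge_0]).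
  assert (A2 : 0 <= ((1 + M) - (1 + p t)) * (y t + y1 t) ^ 2)
    by (apply Rmult_le_pos; [lra|apply pow2_ge_0]).
  assert (A3 : 0 <= (1 + p t + (1 + M)) * (y t - y1 t) ^ 2)
    by (apply Rmult_le_pos; [lra|apply pow2_ge_0]).
  assert (A4 : 0 <= ((1 + M) - (1 + p t)) * (y t - y1 t) ^ 2)
    by (apply Rmult_le_pos; [lra|apply pow2_ge_0]).
  nra. }
split.
- assert (- (y x ^ 2 + y1 x ^ 2) <= - (y 0 ^ 2 + y1 0 ^ 2) * exp (- (1 + M) * x)).
  { apply (gronwall (fun t => - (y t ^ 2 + y1 t ^ 2)) (fun t => - dE t)); [| |exact Hx].
    - intros t _; apply (is_derive_continuous _ _ (- dE t)), (is_derive_opp (fun t => y t ^ 2 + y1 t ^ 2)), HdE.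
    - intros t Ht; split; [apply (is_derive_opp (fun t => y t ^ 2 + y1 t ^ 2)), HdE|].
      specialize (Hb t Ht); lra. }
  rewrite H0, H1 in H; lra.
- assert (y x ^ 2 + y1 x ^ 2 <= (y 0 ^ 2 + y1 0 ^ 2) * exp ((1 + M) * x)).
  { apply (gronwall (fun t => y t ^ 2 + y1 t ^ 2) dE); [| |exact Hx].
    - intros t _; eapply is_derive_continuous, HdE.
    - intros t Ht; split; [apply HdE|apply Hb, Ht]. }
  rewrite H0, H1 in H; lra.
Qed.

(** The exponent is generous, so as to share one constant with [stability]. As that constant is at
    least 1, bounding y^2 by it also bounds |y|. *)
Lemma solution_bound (p y y1 : R -> R) (M : R) :
  solves p y y1 -> (forall x, 0 <= x <= 1 -> Rabs (p x) <= M) ->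
  forall x, 0 <= x <= 1 -> Rabs (y x) <= exp (3 + 2 * M).
Proof.
intros H HM x Hx; pose proof (energy_bounds p y y1 M H HM x Hx) as [_ HE].
assert (0 <= M) by (pose proof (Rabs_pos (p x)); specialize (HM x Hx); lra).
assert (exp ((1 + M) * x) <= exp (3 + 2 * M)) by (apply exp_nondecreasing; nra).
pose proof (exp_ineq1_le (3 + 2 * M)).
pose proof (pow2_ge_0 (y1 x)); apply Rabs_le; split; nra.
Qed.

(** The difference satisfies (y - z)'' = p (y - z) + (p - r) z with zero initial data and a forcing
    term of size at most d |z|; Gronwall is applied to its energy. *)
Lemma stability (p r y y1 z z1 : R -> R) (M d : R) :
  solves p y y1 -> solves r z z1 ->
  (forall x, 0 <= x <= 1 -> Rabs (p x) <= M) ->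
  (forall x, 0 <= x <= 1 -> Rabs (r x) <= M) ->
  (forall x, 0 <= x <= 1 -> Rabs (p x - r x) <= d) ->
  forall x, 0 <= x <= 1 ->
    Rabs (y x - z x) <= exp (3 + 2 * M) * d /\ Rabs (y1 x - z1 x) <= exp (3 + 2 * M) * d.
Proof.
intros Hy Hz Hp Hr Hpr x Hx.
assert (M0 : 0 <= M) by (pose proof (Rabs_pos (p x)); specialize (Hp x Hx); lra).
assert (d0 : 0 <= d) by (pose proof (Rabs_pos (p x - r x)); specialize (Hpr x Hx); lra).
assert (Ez : forall t, 0 <= t <= 1 -> z t ^ 2 <= exp (1 + M)).
{ intros t Ht; pose proof (energy_bounds r z z1 M Hz Hr t Ht) as [_ HE].
  assert (exp ((1 + M) * t) <= exp (1 + M)) by (apply exp_nondecreasing; nra).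
  pose proof (pow2_ge_0 (z1 t)); lra. }
destruct Hy as (y0 & y10 & Dy); destruct Hz as (z0 & z10 & Dz).
(* This constant dominates the squared forcing term. Adding it to the energy makes the differential
   inequality homogeneous: E' <= (2 + M) E. *)
set (c := d ^ 2 * exp (1 + M)).
set (E := fun t => (y t - z t) ^ 2 + (y1 t - z1 t) ^ 2 + c).
set (dE := fun t => 2 * (y t - z t) * (y1 t - z1 t)
                  + 2 * (y1 t - z1 t) * (p t * y t - r t * z t)).
assert (HdE : forall t, is_derive E t (dE t)).
{ intros t; destruct (Dy t) as [D1 D2]; destruct (Dz t) as [D3 D4].
  evar_last.
  - apply (is_derive_plus (fun t => (y t - z t) ^ 2 + (y1 t - z1 t) ^ 2) (fun _ => c));
      [|apply (is_derive_const c)].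
    apply (is_derive_plus (fun t => (y t - z t) ^ 2) (fun t => (y1 t - z1 t) ^ 2));
      [apply is_derive_pow, (is_derive_minus y z); eassumption
      |apply is_derive_pow, (is_derive_minus y1 z1); eassumption].
  - unfold dE, minus, plus, opp, zero; simpl; ring. }
assert (HE : E x <= E 0 * exp ((2 + M) * x)).
{ apply (gronwall E dE); [| |exact Hx].
  - intros t _; eapply is_derive_continuous, HdE.
  - intros t Ht; split; [apply HdE|]; unfold dE, E.
    assert (Ht' : 0 <= t <= 1) by lra.
    assert (Bp : - M <= p t <= M) by (apply Rabs_le_between, Hp; lra).
    assert (Bd : - d <= p t - r t <= d) by (apply Rabs_le_between, Hpr; lra).
    specialize (Ez t Ht').
    set (a := y t - z t); set (b := y1 t - z1 t).
    replace (p t * y t - r t * z t) with (p t * a + (p t - r t) * z t) by (unfold a; ring).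
    set (s := p t - r t) in *.
    assert (K1 : 2 * a * b + 2 * b * (p t * a) <= (1 + M) * (a ^ 2 + b ^ 2)).
    { assert (0 <= (1 + p t + (1 + M)) * (a - b) ^ 2)
        by (apply Rmult_le_pos; [lra|apply pow2_ge_0]).
      assert (0 <= ((1 + M) - (1 + p t)) * (a + b) ^ 2)
        by (apply Rmult_le_pos; [lra|apply pow2_ge_0]).
      nra. }
    assert (K2 : 2 * b * (s * z t) <= b ^ 2 + c).
    { assert (s ^ 2 <= d ^ 2) by nra.
      assert ((s * z t) ^ 2 <= c).
      { rewrite Rpow_mult_distr; unfold c.
        apply Rmult_le_compat; try apply pow2_ge_0; assumption. }
      pose proof (pow2_ge_0 (b - s * z t)); nra. }
    assert (0 <= c) by (apply Rmult_le_pos; [apply pow2_ge_0|apply Rlt_le, exp_pos]).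
    pose proof (pow2_ge_0 a); pose proof (pow2_ge_0 b); nra. }
(* Since E(0) = c, the exponents 1 + M and 2 + M add up to 3 + 2 M. *)
assert (HB : E x <= d ^ 2 * exp (3 + 2 * M)).
{ apply Rle_trans with (1 := HE); unfold E, c.
  rewrite y0, y10, z0, z10.
  replace ((0 - 0) ^ 2 + (1 - 1) ^ 2 + d ^ 2 * exp (1 + M)) with (d ^ 2 * exp (1 + M)) by ring.
  rewrite Rmult_assoc, <- exp_plus; apply Rmult_le_compat_l; [apply pow2_ge_0|].
  apply exp_nondecreasing; nra. }
assert (c0 : 0 <= c) by (apply Rmult_le_pos; [apply pow2_ge_0|apply Rlt_le, exp_pos]).
pose proof (exp_ineq1_le (3 + 2 * M)) as He; unfold E in HB; clear HE.
set (X := exp (3 + 2 * M)) in *.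
assert (HX : d ^ 2 * X <= (X * d) ^ 2).
{ replace ((X * d) ^ 2) with (d ^ 2 * (X * X)) by ring.
  apply Rmult_le_compat_l; [apply pow2_ge_0|nra]. }
assert (HXd : 0 <= X * d) by (apply Rmult_le_pos; lra).
pose proof (pow2_ge_0 (y x - z x)); pose proof (pow2_ge_0 (y1 x - z1 x)).
split; apply Rabs_le; split; nra.
Qed.

(** The slope is 1 at 0, so by continuity it stays above 1/2 nearby. *)
Lemma solves_near_0 (p y y1 : R -> R) :
  solves p y y1 -> exists a, 0 < a <= 1 /\ forall x, 0 <= x <= a -> x / 2 <= y x.
Proof.
intros (H0 & H1 & Hd).
assert (Hc : continuous y1 0) by (eapply is_derive_continuous, Hd).
apply continuity_pt_filterlim in Hc.
destruct (Hc (/ 2)) as [e [He Hy]]; [lra|]; simpl in Hy; unfold Rdist in Hy.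
exists (Rmin 1 (e / 2)); split; [split; [apply Rmin_pos; lra|apply Rmin_l]|].
intros x Hx; assert (x <= e / 2) by (pose proof (Rmin_r 1 (e / 2)); lra).
assert (y 0 - 0 / 2 <= y x - x / 2); [|lra].
apply (nondecreasing_le (fun t => y t - t / 2) (fun t => y1 t - / 2)); [lra| |].
- intros t; apply (is_derive_minus y (fun t => t / 2)); [apply Hd|].
  auto_derive; [trivial|field].
- intros t Ht.
  assert (B : Rabs (y1 t - y1 0) < / 2).
  { apply Hy; split; [split; [exact I|lra]|]; rewrite Rminus_0_r, Rabs_right; lra. }
  apply Rabs_def2 in B; lra.
Qed.

Lemma solves_continuous (p y y1 : R -> R) (x : R) :
  solves p y y1 -> continuous y x /\ continuous y1 x.
Proof.
intros (_ & _ & Hd); destruct (Hd x) as [D1 D2].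
split; [exact (is_derive_continuous _ _ _ D1)|exact (is_derive_continuous _ _ _ D2)].
Qed.

(** As y vanishes at 0, positivity can only be quantified relative to x: slope 1/2 near 0, a
    positive minimum on the remaining compact interval. *)
Lemma solves_linear_lower (p y y1 : R -> R) :
  solves p y y1 -> (forall x, 0 < x <= 1 -> 0 < y x) ->
  exists c, 0 < c /\ forall x, 0 <= x <= 1 -> c * x <= y x.
Proof.
intros Hs Hp; destruct (solves_near_0 _ _ _ Hs) as [a [Ha Hy]].
destruct (continuity_ab_min y a 1) as [m [Hm Hma]]; [lra| |].
{ intros c _; apply continuity_pt_filterlim, (solves_continuous p y y1 c Hs). }
assert (0 < y m) by (apply Hp; lra).
exists (Rmin (/ 2) (y m)); split; [apply Rmin_pos; lra|].
intros x Hx; pose proof (Rmin_l (/ 2) (y m)); pose proof (Rmin_r (/ 2) (y m)).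
assert (0 < Rmin (/ 2) (y m)) by (apply Rmin_pos; lra).
destruct (Rle_or_lt x a); [specialize (Hy x); nra|].
specialize (Hm x); nra.
Qed.

(** Here (y y')' = y'^2 + p y^2 >= 0, so y^2 is nondecreasing and y, once positive, never returns to
    0. *)
Lemma solves_pos_of_nonneg (p y y1 : R -> R) :
  solves p y y1 -> (forall x, 0 <= p x) -> forall x, 0 < x <= 1 -> 0 < y x.
Proof.
intros Hs Hp.
destruct (solves_near_0 _ _ _ Hs) as [a [Ha Hy]].
pose proof Hs as (H0 & H1 & Hd).
assert (Hyy : forall x, 0 <= x -> 0 <= y x * y1 x).
{ intros x Hx; replace 0 with (y 0 * y1 0) at 1 by (rewrite H0; ring).
  apply (nondecreasing_le (fun t => y t * y1 t) (fun t => y1 t * y1 t + y t * (p t * y t))); [exact Hx| |].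
  - intros t; destruct (Hd t); apply (is_derive_mult y y1); [assumption|assumption|].
    intros; apply Rmult_comm.
  - intros t _; specialize (Hp t); nra. }
assert (Hmon : forall s t, 0 <= s <= t -> y s ^ 2 <= y t ^ 2).
{ intros s t Hst.
  apply (nondecreasing_le (fun t => y t ^ 2) (fun t => 2 * (y t * y1 t))); [lra| |].
  - intros w; evar_last; [exact (is_derive_pow y 2 w _ (proj1 (Hd w)))|simpl; ring].
  - intros w Hw; specialize (Hyy w); lra. }
intros x Hx; set (t := Rmin a x).
assert (Ht : 0 < t <= a /\ t <= x)
  by (unfold t; pose proof (Rmin_l a x); pose proof (Rmin_r a x);
      assert (0 < Rmin a x) by (apply Rmin_pos; lra); lra).
assert (Hyt : 0 < y t) by (specialize (Hy t); lra).
destruct (Rlt_or_le 0 (y x)) as [Hyx|Hyx]; [exact Hyx|exfalso].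
destruct (IVT_gen_consistent y t x 0) as [c [Hc Hc0]].
- intros w; apply (solves_continuous p y y1 w Hs).
- rewrite Rmin_right, Rmax_left by lra; lra.
- rewrite Rmin_left, Rmax_right in Hc by lra.
  specialize (Hmon t c); rewrite Hc0 in Hmon; nra.
Qed.

Lemma solves_no_double_zero (p y y1 : R -> R) (M x : R) :
  solves p y y1 -> (forall t, 0 <= t <= 1 -> Rabs (p t) <= M) -> 0 <= x <= 1 ->
  y x = 0 -> y1 x <> 0.
Proof.
intros Hs HM Hx E0 E1; pose proof (energy_bounds p y y1 M Hs HM x Hx) as [HE _].
pose proof (exp_pos (- (1 + M) * x)); rewrite E0, E1 in HE; lra.
Qed.

(** An interior zero would be a minimum, hence a double zero, which the lower energy bound
    excludes. *)
Lemma solves_nonneg_pos (p y y1 : R -> R) (M : R) :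
  solves p y y1 -> (forall t, 0 <= t <= 1 -> Rabs (p t) <= M) ->
  (forall x, 0 <= x <= 1 -> 0 <= y x) -> forall x, 0 < x < 1 -> 0 < y x.
Proof.
intros Hs HM Hy x Hx; destruct (Hy x) as [H|H]; [lra|exact H|exfalso].
apply (solves_no_double_zero p y y1 M x); try assumption; [lra|now symmetry|].
destruct Hs as (_ & _ & Hd).
assert (D : derivable_pt_lim y x (y1 x)) by apply is_derive_Reals, Hd.
assert (pr : derivable_pt y x) by (exists (y1 x); exact D).
rewrite <- (derive_pt_eq_0 y x (y1 x) pr D).
apply (deriv_minimum y 0 1 x pr); [lra|lra|].
intros t H1 H2; rewrite <- H; apply Hy; lra.
Qed.

(** The integrand is the derivative of y' z - y z', which vanishes at 0. *)
Lemma green (p r y y1 z z1 : R -> R) :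
  solves p y y1 -> solves r z z1 ->
  (forall x, continuous p x) -> (forall x, continuous r x) ->
  RInt (fun x => (p x - r x) * (y x * z x)) 0 1 = y1 1 * z 1 - y 1 * z1 1.
Proof.
intros Hy Hz Cp Cr.
assert (Cy := fun x => solves_continuous p y y1 x Hy).
assert (Cz := fun x => solves_continuous r z z1 x Hz).
destruct Hy as (y0 & y10 & Dy); destruct Hz as (z0 & z10 & Dz).
apply (is_RInt_unique (V := R_CompleteNormedModule)).
evar_last.
- apply (is_RInt_derive (fun x => y1 x * z x - y x * z1 x)).
  + intros x _; destruct (Dy x) as [D1 D2]; destruct (Dz x) as [D3 D4].
    evar_last.
    * apply (is_derive_minus (fun x => y1 x * z x) (fun x => y x * z1 x));
        apply (is_derive_mult (K := R_AbsRing)); try eassumption; intros; apply Rmult_comm.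
    * unfold minus, plus, opp, mult; simpl; ring.
  + intros x _; apply (continuous_mult (fun x => p x - r x)).
    * apply (continuous_minus p r); auto.
    * apply (continuous_mult y z); [apply Cy|apply Cz].
- unfold minus, plus, opp; simpl; rewrite y0, z0; ring.
Qed.

(** * The ground state *)

Definition shift (Q : R -> R) (l x : R) : R := Q x - l.

Definition potential (Q : R -> R) : Prop :=
  (forall x, continuous Q x) /\ forall x, 0 <= Q x <= 1.

Lemma shift_bound (Q : R -> R) (l L x : R) :
  potential Q -> Rabs l <= L -> Rabs (shift Q l x) <= 1 + L.
Proof.
intros [_ HQ] Hl; specialize (HQ x); apply Rabs_le_between in Hl.
apply Rabs_le; unfold shift; lra.
Qed.

Lemma shift_continuous (Q : R -> R) (l x : R) : potential Q -> continuous (shift Q l) x.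
Proof. intros [HQ _]; apply (continuous_minus Q (fun _ => l)); [apply HQ|apply continuous_const]. Qed.

Lemma shift_solves (Q : R -> R) (l : R) :
  potential Q -> solves (shift Q l) (phi (shift Q l)) (phi1 (shift Q l)).
Proof.
intros HQ; apply phi_solves with (1 + Rabs l).
- intros t; now apply shift_continuous.
- intros t; apply shift_bound; [exact HQ|apply Rle_refl].
Qed.

(** The factor x comes from integrating the derivative estimate of [stability] from 0, where both
    solutions vanish. It matches the linear lower bound of [solves_linear_lower]. *)
Lemma shift_stability (Q : R -> R) (l m L : R) :
  potential Q -> Rabs l <= L -> Rabs m <= L -> forall x, 0 <= x <= 1 ->
  Rabs (phi (shift Q m) x - phi (shift Q l) x) <= exp (3 + 2 * (1 + L)) * Rabs (m - l) * x.
Proof.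
intros HQ Hl Hm x Hx.
set (D := exp (3 + 2 * (1 + L)) * Rabs (m - l)).
assert (Hst : forall t, 0 <= t <= 1 -> Rabs (phi1 (shift Q m) t - phi1 (shift Q l) t) <= D).
{ intros t Ht.
  apply (stability (shift Q m) (shift Q l) (phi (shift Q m)) _ (phi (shift Q l)));
    try (now apply shift_solves); try (intros; now apply shift_bound); [|exact Ht].
  intros s _; unfold shift; right; rewrite <- (Rabs_Ropp (m - l)); f_equal; ring. }
destruct (shift_solves Q l HQ) as (l0 & _ & Dl); destruct (shift_solves Q m HQ) as (m0 & _ & Dm).
apply Rabs_le; split.
- assert (phi (shift Q m) 0 - phi (shift Q l) 0 + D * 0
       <= phi (shift Q m) x - phi (shift Q l) x + D * x); [|rewrite l0, m0 in *; lra].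
  apply (nondecreasing_le (fun t => phi (shift Q m) t - phi (shift Q l) t + D * t)
     (fun t => phi1 (shift Q m) t - phi1 (shift Q l) t + D)); [lra| |].
  + intros t; apply (is_derive_plus (fun t => phi (shift Q m) t - phi (shift Q l) t) (fun t => D * t)).
    * apply (is_derive_minus (phi (shift Q m)) (phi (shift Q l))); [apply Dm|apply Dl].
    * auto_derive; [trivial|ring].
  + intros t Ht; specialize (Hst t); apply Rabs_le_between in Hst; lra.
- assert (D * 0 - (phi (shift Q m) 0 - phi (shift Q l) 0)
       <= D * x - (phi (shift Q m) x - phi (shift Q l) x)); [|rewrite l0, m0 in *; lra].
  apply (nondecreasing_le (fun t => D * t - (phi (shift Q m) t - phi (shift Q l) t))
     (fun t => D - (phi1 (shift Q m) t - phi1 (shift Q l) t))); [lra| |].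
  + intros t; apply (is_derive_minus (fun t => D * t) (fun t => phi (shift Q m) t - phi (shift Q l) t)).
    * auto_derive; [trivial|ring].
    * apply (is_derive_minus (phi (shift Q m)) (phi (shift Q l))); [apply Dm|apply Dl].
  + intros t Ht; specialize (Hst t); apply Rabs_le_between in Hst; lra.
Qed.

(** Including the endpoint 1 makes this an open condition on l, one that fails at an eigenvalue. *)
Definition positive_shot (Q : R -> R) (l : R) : Prop :=
  forall x, 0 < x <= 1 -> 0 < phi (shift Q l) x.

Lemma positive_shot_nonpos (Q : R -> R) (l : R) :
  potential Q -> l <= 0 -> positive_shot Q l.
Proof.
intros HQ Hl; refine (solves_pos_of_nonneg _ _ _ (shift_solves Q l HQ) _).
intros x; destruct HQ as [_ HQ]; specialize (HQ x); unfold shift; lra.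
Qed.

Lemma positive_shot_open (Q : R -> R) (l : R) :
  potential Q -> positive_shot Q l ->
  exists e, 0 < e /\ forall m, Rabs (m - l) < e -> positive_shot Q m.
Proof.
intros HQ Hl.
destruct (solves_linear_lower _ _ _ (shift_solves Q l HQ) Hl) as [c [Hc Hlow]].
set (B := exp (3 + 2 * (1 + (1 + Rabs l)))).
assert (HB : 0 < B) by apply exp_pos.
(* Below c / B the perturbation is smaller than the lower bound c x; the cap 1 keeps |m| within 1 +
   |l|, the range for which [B] is valid. *)
exists (Rmin 1 (c / B)); split; [apply Rmin_pos; [lra|now apply Rdiv_lt_0_compat]|].
intros m Hm x Hx.
pose proof (Rmin_l 1 (c / B)); pose proof (Rmin_r 1 (c / B)).
assert (HmB : B * Rabs (m - l) < c).
{ replace c with (B * (c / B)) by (field; lra); apply Rmult_lt_compat_l; lra. }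
assert (Hs : Rabs (phi (shift Q m) x - phi (shift Q l) x) <= B * Rabs (m - l) * x).
{ apply shift_stability; [exact HQ|lra| |lra].
  replace m with ((m - l) + l) by ring; apply Rle_trans with (1 := Rabs_triang _ _); lra. }
apply Rabs_le_between in Hs; specialize (Hlow x); nra.
Qed.

(* Green's identity against sin (pi x), the ground state of the zero potential. *)
Lemma positive_shot_bound (Q : R -> R) (l : R) :
  potential Q -> positive_shot Q l -> l <= 1 + PI ^ 2.
Proof.
intros HQ Hl; destruct (Rle_or_lt l (1 + PI ^ 2)) as [H|H]; [exact H|exfalso].
pose proof PI_RGT_0 as Hpi.
assert (Hsin : solves (fun _ => - PI ^ 2) (fun x => sin (PI * x) / PI) (fun x => cos (PI * x))).
{ split; [|split].
  - rewrite Rmult_0_r, sin_0; field; lra.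
  - rewrite Rmult_0_r; apply cos_0.
  - intros x; split; auto_derive; try trivial; field; lra. }
set (f := fun x => (shift Q l x - - PI ^ 2) * (phi (shift Q l) x * (sin (PI * x) / PI))).
assert (HG : RInt f 0 1 = phi1 (shift Q l) 1 * (sin (PI * 1) / PI) - phi (shift Q l) 1 * cos (PI * 1))
  by exact (green _ _ _ _ _ _ (shift_solves Q l HQ) Hsin (fun x => shift_continuous Q l x HQ)
    (fun x => continuous_const (- PI ^ 2) x)).
rewrite Rmult_1_r, sin_PI, cos_PI in HG.
assert (Cf : forall x, continuous f x).
{ intros x; apply (continuous_mult (fun x => shift Q l x - - PI ^ 2)).
  - apply (continuous_minus (shift Q l)); [now apply shift_continuous|apply continuous_const].
  - apply (continuous_mult (phi (shift Q l))).
    + apply (solves_continuous _ _ _ x (shift_solves Q l HQ)).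
    + apply (solves_continuous _ _ _ x Hsin). }
(* For l > 1 + PI^2 the integrand is negative, whereas Green's identity evaluates the integral to
   phi(1) > 0. *)
assert (Hneg : 0 < RInt (fun x => opp (f x)) 0 1).
{ apply RInt_gt_0; [lra| |intros x _; apply (continuous_opp f), Cf].
  intros x Hx; destruct HQ as [_ HQ']; specialize (HQ' x).
  assert (0 < phi (shift Q l) x) by (apply Hl; lra).
  assert (0 < sin (PI * x) / PI).
  { apply Rdiv_lt_0_compat; [apply sin_gt_0; nra|exact Hpi]. }
  assert (0 < phi (shift Q l) x * (sin (PI * x) / PI)) by now apply Rmult_lt_0_compat.
  assert (shift Q l x - - PI ^ 2 < 0) by (unfold shift; lra).
  change (0 < - f x); unfold f; nra. }
rewrite (RInt_opp (V := R_CompleteNormedModule) f) in Hneg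
  by (apply ex_RInt_cont, Cf).
assert (Hneg' : 0 < - RInt f 0 1) by exact Hneg; rewrite HG in Hneg'.
assert (0 < phi (shift Q l) 1) by (apply Hl; lra).
unfold Rdiv in Hneg'; lra.
Qed.

(** Let l be the supremum of the levels up to which all shots are positive. By openness the shot at
    l is not positive; by continuity in the level it is nonnegative, hence positive inside (0,1). So
    it must vanish at 1. *)
Lemma ground_state_exists (Q : R -> R) :
  potential Q ->
  exists l, 0 <= l <= 1 + PI ^ 2 /\ phi (shift Q l) 1 = 0 /\
    (forall x, 0 < x < 1 -> 0 < phi (shift Q l) x) /\
    (forall m, m < l -> 0 < phi (shift Q m) 1).
Proof.
intros HQ.
(* Quantifying over all m <= l makes the set downward closed, so every m below the supremum is a
   positive shot. *)
destruct (completeness (fun l => forall m, m <= l -> positive_shot Q m)) as [l [Hub Hlub]].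
- exists (1 + PI ^ 2); intros l Hl; apply positive_shot_bound with Q; [exact HQ|apply Hl, Rle_refl].
- exists 0; intros m Hm; now apply positive_shot_nonpos.
- assert (l0 : 0 <= l) by (apply Hub; intros m Hm; now apply positive_shot_nonpos).
  assert (Hlt : forall m, m < l -> positive_shot Q m).
  { intros m Hm; destruct (excluded_middle_informative (positive_shot Q m)) as [H|H]; [exact H|exfalso].
    assert (l <= m); [|lra]; apply Hlub; intros k Hk.
    destruct (Rle_or_lt k m) as [H'|H']; [exact H'|exfalso; apply H, Hk; lra]. }
  assert (Hnot : ~ positive_shot Q l).
  { intros Hl; destruct (positive_shot_open Q l HQ Hl) as [e [He H]].
    assert (l + e / 2 <= l); [|lra]; apply Hub; intros m Hm.
    destruct (Rlt_or_le m l) as [Hml|Hml]; [now apply Hlt|].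
    apply H; rewrite Rabs_right; lra. }
  (* A negative value would persist at the slightly lower level l - e / 2, where the shot is
     positive. *)
  assert (Hnn : forall x, 0 <= x <= 1 -> 0 <= phi (shift Q l) x).
  { intros x Hx; destruct (Rle_or_lt 0 (phi (shift Q l) x)) as [H|H]; [exact H|exfalso].
    set (B := exp (3 + 2 * (1 + (1 + l)))).
    assert (HB : 0 < B) by apply exp_pos.
    set (e := Rmin 1 (- phi (shift Q l) x / B)).
    assert (He : 0 < e) by (apply Rmin_pos; [lra|apply Rdiv_lt_0_compat; lra]).
    assert (He' : B * e <= - phi (shift Q l) x).
    { replace (- phi (shift Q l) x) with (B * (- phi (shift Q l) x / B)) by (field; lra).
      apply Rmult_le_compat_l; [lra|apply Rmin_r]. }
    assert (He1 : e <= 1) by apply Rmin_l.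
    set (m := l - e / 2).
    assert (Hs : Rabs (phi (shift Q m) x - phi (shift Q l) x) <= B * Rabs (m - l) * x).
    { apply shift_stability; [exact HQ| | |exact Hx]; apply Rabs_le; unfold m; lra. }
    replace (m - l) with (- (e / 2)) in Hs by (unfold m; ring).
    rewrite Rabs_Ropp, (Rabs_right (e / 2)) in Hs by lra; apply Rabs_le_between in Hs.
    assert (0 < B * e) by now apply Rmult_lt_0_compat.
    assert (x0 : 0 < x).
    { destruct (Rle_or_lt x 0); [|assumption].
      destruct (shift_solves Q l HQ) as [E _]; replace x with 0 in H by lra; lra. }
    assert (0 < phi (shift Q m) x) by (apply Hlt; unfold m; lra); nra. }
  assert (Hpos : forall x, 0 < x < 1 -> 0 < phi (shift Q l) x).
  { refine (solves_nonneg_pos _ _ _ (1 + Rabs l) (shift_solves Q l HQ) _ Hnn).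
    intros t _; apply shift_bound; [exact HQ|apply Rle_refl]. }
  exists l; repeat split; [exact l0| | |exact Hpos|].
  + apply Hlub; intros k Hk; apply positive_shot_bound with Q; [exact HQ|apply Hk, Rle_refl].
  + destruct (Hnn 1) as [H1|H1]; [lra| |now symmetry].
    exfalso; apply Hnot; intros x Hx.
    destruct (proj2 Hx) as [H|H]; [apply Hpos; lra|now rewrite H].
  + intros m Hm; apply Hlt; lra.
Qed.

(** * Eigenfunctions and the smallest eigenvalue *)

Definition admissible (q : R -> R) : Prop :=
  forall x, I01 x -> I01 (q x) /\ continue_in q I01 x.

Lemma classQ_admissible (q : R -> R) : classQ q -> admissible q.
Proof.
intros [HI (q1 & q2 & HC & _)] x Hx; split; [now apply HI|].
destruct (HC x Hx) as (HD & _); exact (cont_deriv _ _ _ _ HD).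
Qed.

Lemma ext_id (f : R -> R) (x : R) : I01 x -> ext f x = f x.
Proof. intros Hx; unfold ext; now rewrite clamp_id. Qed.

Lemma admissible_potential (q : R -> R) : admissible q -> potential (ext q).
Proof.
intros Hq; split.
- apply continuous_ext01; intros x Hx; now apply Hq.
- intros x; apply Hq, clamp_I01.
Qed.

Lemma is_derive_ext01 (f : R -> R) (x l : R) :
  0 < x < 1 -> is_derive f x l -> is_derive (ext f) x l.
Proof.
intros Hx; apply is_derive_ext_loc.
apply (open_and (fun y => 0 < y) (fun y => y < 1)) in Hx;
  [|apply open_gt|apply open_lt].
revert Hx; apply filter_imp; intros y Hy; symmetry; apply ext_id; unfold I01; lra.
Qed.

(** Uniqueness for the Cauchy problem: u - u'(0) phi solves the same equation with zero data at 0,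
    so Gronwall makes its energy vanish. The multiple is nonzero because u is. *)
Lemma eigenfunction_multiple (q u : R -> R) (l : R) :
  admissible q -> is_eigenfunction q l u ->
  exists b, b <> 0 /\ forall x, I01 x -> u x = b * phi (shift (ext q) l) x.
Proof.
intros Hq [(u1 & u2 & HC & Heq) (u0 & _ & x0 & Hx0 & Hux0)].
pose proof (admissible_potential q Hq) as HQ.
assert (Cu : forall x, continuous (ext u) x).
{ apply continuous_ext01; intros x Hx; destruct (HC x Hx) as (D & _); exact (cont_deriv _ _ _ _ D). }
assert (Cu1 : forall x, continuous (ext u1) x).
{ apply continuous_ext01; intros x Hx; destruct (HC x Hx) as (_ & D & _); exact (cont_deriv _ _ _ _ D). }
pose proof (shift_solves (ext q) l HQ) as Hs.
assert (Cp := fun x => solves_continuous _ _ _ x Hs).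
destruct Hs as (p0 & p10 & Dp).
set (y := phi (shift (ext q) l)) in *; set (y1 := phi1 (shift (ext q) l)) in *.
clearbody y y1; set (b := u1 0).
set (z := fun t => ext u t - b * y t); set (z1 := fun t => ext u1 t - b * y1 t).
assert (I0 : I01 0) by (unfold I01; lra).
assert (Hz : forall x, I01 x -> z x ^ 2 + z1 x ^ 2 <= 0).
{ intros x Hx.
  replace 0 with ((z 0 ^ 2 + z1 0 ^ 2) * exp ((2 + Rabs l) * x)).
  2: { unfold z, z1; rewrite !ext_id, u0, p0, p10 by exact I0; unfold b; ring. }
  apply (gronwall (fun t => z t ^ 2 + z1 t ^ 2)
    (fun t => 2 * z t * z1 t + 2 * z1 t * (shift (ext q) l t * z t))); [| |exact Hx].
  - intros t _.
    assert (Cz : continuous z t).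
    { apply (continuous_minus (ext u) (fun t => b * y t)); [apply Cu|].
      apply (continuous_mult (fun _ => b) y); [apply continuous_const|apply Cp]. }
    assert (Cz1 : continuous z1 t).
    { apply (continuous_minus (ext u1) (fun t => b * y1 t)); [apply Cu1|].
      apply (continuous_mult (fun _ => b) y1); [apply continuous_const|apply Cp]. }
    apply (continuous_plus (fun t => z t ^ 2) (fun t => z1 t ^ 2));
      now apply continuous_sqr.
  - intros t Ht.
    assert (It : I01 t) by (unfold I01; lra).
    destruct (HC t It) as (D1 & D2 & _); destruct (Dp t) as [D3 D4].
    apply (is_derive_D_in _ _ _ Ht) in D1; apply (is_derive_D_in _ _ _ Ht) in D2.
    apply (is_derive_ext01 _ _ _ Ht) in D1; apply (is_derive_ext01 _ _ _ Ht) in D2.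
    assert (Dz : is_derive z t (z1 t)).
    { evar_last; [apply (is_derive_minus (ext u) (fun t => b * y t)); [exact D1|]|].
      - apply is_derive_scal, D3.
      - unfold z1, minus, plus, opp; simpl; rewrite ext_id by exact It; ring. }
    assert (Dz1 : is_derive z1 t (shift (ext q) l t * z t)).
    { evar_last; [apply (is_derive_minus (ext u1) (fun t => b * y1 t)); [exact D2|]|].
      - apply is_derive_scal, D4.
      - specialize (Heq t Ht).
        unfold z, shift, minus, plus, opp; simpl; rewrite !ext_id by exact It.
        replace (u2 t) with ((q t - l) * u t) by lra; ring. }
    split.
    + evar_last; [apply (is_derive_plus (fun t => z t ^ 2) (fun t => z1 t ^ 2));
        apply is_derive_pow; eassumption|].
      unfold plus; simpl; ring.
    + assert (Hb : - (1 + Rabs l) <= shift (ext q) l t <= 1 + Rabs l)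
        by (apply Rabs_le_between, shift_bound; [exact HQ|apply Rle_refl]).
      set (p := shift (ext q) l t) in *; set (M := Rabs l) in *.
      assert (0 <= (1 + p + (2 + M)) * (z t - z1 t) ^ 2)
        by (apply Rmult_le_pos; [lra|apply pow2_ge_0]).
      assert (0 <= ((2 + M) - (1 + p)) * (z t + z1 t) ^ 2)
        by (apply Rmult_le_pos; [lra|apply pow2_ge_0]).
      nra. }
assert (Hu : forall x, I01 x -> u x = b * y x).
{ intros x Hx; specialize (Hz x Hx); pose proof (pow2_ge_0 (z x)); pose proof (pow2_ge_0 (z1 x)).
  assert (z x = 0) as E by (apply Rsqr_0_uniq; unfold Rsqr; nra).
  unfold z in E; rewrite ext_id in E by exact Hx; lra. }
exists b; split; [|exact Hu].
intros Hb; apply Hux0; rewrite Hu by exact Hx0; rewrite Hb; ring.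
Qed.

Lemma phi_eigenfunction (q : R -> R) (l : R) :
  admissible q -> phi (shift (ext q) l) 1 = 0 ->
  is_eigenfunction q l (phi (shift (ext q) l)).
Proof.
intros Hq H1; pose proof (admissible_potential q Hq) as HQ.
pose proof (shift_solves (ext q) l HQ) as Hs; pose proof Hs as (p0 & _ & Dp).
split; [|split; [exact p0|split; [exact H1|]]].
- exists (phi1 (shift (ext q) l)), (fun x => shift (ext q) l x * phi (shift (ext q) l) x); split.
  + intros x Hx; destruct (Dp x) as [D1 D2].
    split; [now apply D_in_is_derive|split; [now apply D_in_is_derive|]].
    apply continue_in_continuous, (continuous_mult (shift (ext q) l)).
    * now apply shift_continuous.
    * apply (solves_continuous _ _ _ x Hs).
  + intros x Hx; unfold shift at 1; rewrite ext_id by (unfold I01; lra); ring.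
- destruct (solves_near_0 _ _ _ Hs) as [a [Ha Hy]].
  exists a; split; [unfold I01; lra|]; specialize (Hy a); lra.
Qed.

(** An eigenfunction at a level m < l would be a nonzero multiple of a shot that is positive at 1.
    So the level l of [ground_state_exists] is the smallest eigenvalue, and uniqueness identifies it
    with the chosen [lambda q]. *)
Lemma lambda_ground_state (q : R -> R) :
  admissible q ->
  0 <= lambda q <= 1 + PI ^ 2 /\ phi (shift (ext q) (lambda q)) 1 = 0 /\
  forall x, 0 < x < 1 -> 0 < phi (shift (ext q) (lambda q)) x.
Proof.
intros Hq; destruct (ground_state_exists _ (admissible_potential q Hq)) as (l & Hl & H1 & Hpos & Hmin).
assert (Hsm : is_smallest_eigenvalue q l).
{ split; [exists (phi (shift (ext q) l)); now apply phi_eigenfunction|].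
  intros m [u Hu]; destruct (Rle_or_lt l m) as [H|H]; [exact H|exfalso].
  destruct (eigenfunction_multiple q u m Hq Hu) as (b & Hb & E).
  destruct Hu as (_ & _ & u1 & _); rewrite E in u1 by (unfold I01; lra).
  specialize (Hmin m H); apply Rmult_integral in u1; destruct u1; lra. }
assert (Hl' : is_smallest_eigenvalue q (lambda q)) by (unfold lambda; apply epsilon_spec; now exists l).
assert (E : l = lambda q) by (apply Rle_antisym; [apply Hsm, Hl'|apply Hl', Hsm]).
subst l; split; [exact Hl|split; [exact H1|exact Hpos]].
Qed.

(** The bound [K] makes the supremum finite, so [norm_inf] is not its default value 0. *)
Lemma norm_inf_ge (f : R -> R) (K x : R) :
  (forall t, I01 t -> Rabs (f t) <= K) -> I01 x -> Rabs (f x) <= norm_inf f.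
Proof.
intros HK Hx; unfold norm_inf.
destruct (Lub_Rbar_correct (fun y => exists x, I01 x /\ y = Rabs (f x))) as [Hub Hl].
assert (H1 := Hub (Rabs (f x)) (ex_intro _ x (conj Hx eq_refl))).
assert (H2 : Rbar_le (Lub_Rbar (fun y => exists x, I01 x /\ y = Rabs (f x))) K)
  by (apply Hl; intros y [t [Ht ->]]; now apply HK).
destruct Lub_Rbar; simpl in *; [exact H1|contradiction|contradiction].
Qed.

(* Both ground states are positive, so Green's identity forces the difference of the
   shifted potentials to change sign. *)
Lemma lambda_monotone (q r : R -> R) (d : R) :
  admissible q -> admissible r -> (forall x, I01 x -> q x - r x <= d) ->
  lambda q - lambda r <= d.
Proof.
intros Hq Hr Hd; destruct (Rle_or_lt (lambda q - lambda r) d) as [H|H]; [exact H|exfalso].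
destruct (lambda_ground_state q Hq) as (_ & Eq & Pq).
destruct (lambda_ground_state r Hr) as (_ & Er & Pr).
apply admissible_potential in Hq as HQ; apply admissible_potential in Hr as HR.
pose proof (shift_solves _ (lambda q) HQ) as Sq; pose proof (shift_solves _ (lambda r) HR) as Sr.
pose proof (green _ _ _ _ _ _ Sr Sq (fun x => shift_continuous _ (lambda r) x HR)
  (fun x => shift_continuous _ (lambda q) x HQ)) as HG.
rewrite Eq, Er in HG.
(* Green's integral is 0 since both ground states vanish at 1; a gap above d would make it
   positive. *)
assert (Hpos : 0 < RInt (fun x => (shift (ext r) (lambda r) x - shift (ext q) (lambda q) x) *
   (phi (shift (ext r) (lambda r)) x * phi (shift (ext q) (lambda q)) x)) 0 1); [|lra].
apply RInt_gt_0; [lra| |].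
- intros x Hx; assert (Ix : I01 x) by (unfold I01; lra).
  repeat apply Rmult_lt_0_compat; [|now apply Pr|now apply Pq].
  unfold shift; rewrite !ext_id by exact Ix; specialize (Hd x Ix); lra.
- intros x _; apply (continuous_mult (fun x => shift (ext r) (lambda r) x - shift (ext q) (lambda q) x)).
  + apply (continuous_minus (shift (ext r) (lambda r))); now apply shift_continuous.
  + apply (continuous_mult (phi (shift (ext r) (lambda r)))).
    * apply (solves_continuous _ _ _ x Sr).
    * apply (solves_continuous _ _ _ x Sq).
Qed.

(** * The eigenvalue expansion *)

(* Since z(0) = z(1) = 0, integration by parts of (1 - t) z'' gives
   int_0^1 (1 - t) p z = -1, and |(1 - t) p z| <= M |z| <= 1/2 + M^2 z^2 / 2. *)
Lemma dirichlet_mass (p z z1 : R -> R) (M : R) :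
  solves p z z1 -> (forall x, continuous p x) -> z 1 = 0 ->
  (forall x, 0 <= x <= 1 -> Rabs (p x) <= M) ->
  1 <= M ^ 2 * RInt (fun x => z x ^ 2) 0 1.
Proof.
intros Hs Cp E1 HM.
assert (Cz := fun x => solves_continuous _ _ _ x Hs); destruct Hs as (E0 & E10 & D).
assert (Cz2 : forall x, continuous (fun x => z x ^ 2) x).
{ intros x; apply continuous_sqr, Cz. }
assert (HG : is_RInt (fun t => - ((1 - t) * (p t * z t))) 0 1 1).
{ evar_last.
  - apply (is_RInt_derive (fun t => - ((1 - t) * z1 t + z t))).
    + intros t _; destruct (D t) as [D1 D2].
      evar_last; [apply (is_derive_opp (fun t => (1 - t) * z1 t + z t)),
         (is_derive_plus (fun t => (1 - t) * z1 t) z); [|exact D1]|].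
      * apply (is_derive_mult (fun t => 1 - t) z1); [|exact D2|intros; apply Rmult_comm].
        instantiate (1 := -1); auto_derive; [trivial|ring].
      * unfold plus, mult, opp; simpl; ring.
    + intros t _; apply (continuous_opp (fun t => (1 - t) * (p t * z t))).
      apply (continuous_mult (fun t => 1 - t)).
      * apply (continuous_minus (fun _ => 1) (fun t => t)); [apply continuous_const|apply continuous_id].
      * apply (continuous_mult p z); [apply Cp|apply Cz].
  - unfold minus, plus, opp; simpl; rewrite E0, E1, E10; ring. }
assert (HR : is_RInt (fun t => / 2 + M ^ 2 / 2 * z t ^ 2) 0 1
   (/ 2 + M ^ 2 / 2 * RInt (fun x => z x ^ 2) 0 1)).
{ evar_last.
  - apply (is_RInt_plus (fun _ => / 2) (fun t => M ^ 2 / 2 * z t ^ 2));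
      [apply (is_RInt_const 0 1 (/ 2))|].
    apply (is_RInt_scal (fun t => z t ^ 2)), (RInt_correct (V := R_CompleteNormedModule)), ex_RInt_cont, Cz2.
  - unfold plus, scal; simpl; unfold mult; simpl; ring. }
assert (Hle : 1 <= / 2 + M ^ 2 / 2 * RInt (fun x => z x ^ 2) 0 1); [|lra].
apply (is_RInt_le _ _ 0 1 _ _ Rle_0_1 HG HR).
intros t Ht; assert (B : - M <= p t <= M) by (apply Rabs_le_between, HM; lra).
assert (Bs : ((1 - t) * p t) ^ 2 <= M ^ 2).
{ assert (p t ^ 2 <= M ^ 2) by nra; pose proof (pow2_ge_0 (p t)).
  rewrite Rpow_mult_distr; assert (0 <= (1 - t) ^ 2 <= 1) by nra; nra. }
(* Expanding the first square gives -(1 - t) p z <= 1/2 + ((1 - t) p z)^2 / 2. *)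
pose proof (pow2_ge_0 (1 + (1 - t) * p t * z t)); pose proof (pow2_ge_0 (z t)); nra.
Qed.

(** With M and B as set in the proof, the constant is the product of b^2 <= M^2, |p1 - p2| <= 2 d,
    |y - z| <= 2 B d and |z| <= B. *)
Lemma lambda_expansion (q r u : R -> R) (d : R) :
  admissible q -> admissible r -> is_normalized_ground_state r u ->
  (forall x, I01 x -> Rabs (q x - r x) <= d) ->
  Rabs (lambda q - lambda r - RInt (fun x => (q x - r x) * u x ^ 2) 0 1)
  <= 4 * (2 + PI ^ 2) ^ 2 * exp (3 + 2 * (2 + PI ^ 2)) ^ 2 * d ^ 2.
Proof.
intros Hq Hr [Hu Hnorm] Hd.
(* [M] bounds both shifted potentials, as the potentials lie in [0,1] and the eigenvalues in
   [0, 1 + PI^2]. *)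
set (M := 2 + PI ^ 2); set (B := exp (3 + 2 * M)).
destruct (eigenfunction_multiple r u (lambda r) Hr Hu) as (b & _ & Eu).
destruct (lambda_ground_state q Hq) as (Lq & Eq & _).
destruct (lambda_ground_state r Hr) as (Lr & Er & _).
apply admissible_potential in Hq as HQ; apply admissible_potential in Hr as HR.
set (c := lambda q - lambda r).
assert (Hc : - d <= c <= d).
{ split.
  - assert (lambda r - lambda q <= d); [|unfold c; lra].
    apply lambda_monotone; try assumption; intros x Hx.
    specialize (Hd x Hx); apply Rabs_le_between in Hd; lra.
  - apply lambda_monotone; try assumption; intros x Hx.
    specialize (Hd x Hx); apply Rabs_le_between in Hd; lra. }
pose proof (shift_solves _ (lambda q) HQ) as Sq; pose proof (shift_solves _ (lambda r) HR) as Sr.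
assert (Cp := fun x => shift_continuous _ (lambda q) x HQ).
assert (Cr := fun x => shift_continuous _ (lambda r) x HR).
assert (Bp : forall x, 0 <= x <= 1 -> Rabs (shift (ext q) (lambda q) x) <= M).
{ intros x _; replace M with (1 + (1 + PI ^ 2)) by (unfold M; ring).
  apply shift_bound; [exact HQ|apply Rabs_le; lra]. }
assert (Br : forall x, 0 <= x <= 1 -> Rabs (shift (ext r) (lambda r) x) <= M).
{ intros x _; replace M with (1 + (1 + PI ^ 2)) by (unfold M; ring).
  apply shift_bound; [exact HR|apply Rabs_le; lra]. }
assert (Hs : forall x, I01 x ->
  shift (ext q) (lambda q) x - shift (ext r) (lambda r) x = q x - r x - c).
{ intros x Hx; unfold shift, c; rewrite !ext_id by exact Hx; ring. }
set (p1 := shift (ext q) (lambda q)) in *; set (p2 := shift (ext r) (lambda r)) in *.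
set (y := phi p1) in *; set (z := phi p2) in *.
assert (Bpr : forall x, 0 <= x <= 1 -> Rabs (p1 x - p2 x) <= 2 * d).
{ intros x Hx; rewrite Hs by exact Hx; specialize (Hd x Hx); apply Rabs_le_between in Hd.
  apply Rabs_le; lra. }
assert (Cy : forall x, continuous y x) by (intros x; apply (solves_continuous _ _ _ x Sq)).
assert (Cz : forall x, continuous z x) by (intros x; apply (solves_continuous _ _ _ x Sr)).
assert (Cyz : forall w x, (forall x, continuous w x) -> continuous (fun x => (p1 x - p2 x) * (w x * z x)) x).
{ intros w x Hw; apply (continuous_mult (fun x => p1 x - p2 x));
    [apply (continuous_minus p1 p2); [apply Cp|apply Cr]|apply (continuous_mult w z); auto]. }
assert (Cz2 : forall x, continuous (fun x => z x ^ 2) x).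
{ intros x; apply continuous_sqr, Cz. }
assert (Hmass := dirichlet_mass p2 z _ M Sr Cr Er Br).
set (m := RInt (fun x => z x ^ 2) 0 1) in Hmass.
assert (Hm : is_RInt (fun x => z x ^ 2) 0 1 m)
  by apply (RInt_correct (V := R_CompleteNormedModule)), ex_RInt_cont, Cz2.
assert (Hbm : b ^ 2 * m = 1).
{ rewrite <- Hnorm; symmetry; apply (is_RInt_unique (V := R_CompleteNormedModule)).
  apply (is_RInt_ext (fun x => scal (b ^ 2) (z x ^ 2))).
  - rewrite Rmin_left, Rmax_right by lra; intros x Hx.
    rewrite Eu by (unfold I01; lra); unfold scal; simpl; unfold mult; simpl; ring.
  - apply (is_RInt_scal (fun x => z x ^ 2)), Hm. }
assert (HG : is_RInt (fun x => (p1 x - p2 x) * (y x * z x)) 0 1 0).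
{ assert (G0 := green _ _ _ _ _ _ Sq Sr Cp Cr); fold y z in G0.
  rewrite Eq, Er, Rmult_0_r, Rmult_0_l, Rminus_0_r in G0.
  evar_last; [|exact G0].
  apply (RInt_correct (V := R_CompleteNormedModule)), ex_RInt_cont; intros x; now apply Cyz. }
set (J := RInt (fun x => (p1 x - p2 x) * (z x * z x)) 0 1).
assert (HJ : is_RInt (fun x => (p1 x - p2 x) * (z x * z x)) 0 1 J).
{ apply (RInt_correct (V := R_CompleteNormedModule)), ex_RInt_cont; intros x; now apply Cyz. }
(* Here q - r = (p1 - p2) + c and u = b z on [0,1]; the normalization [Hbm] then turns the last term
   into c. *)
assert (HI : RInt (fun x => (q x - r x) * u x ^ 2) 0 1 = b ^ 2 * J + c * (b ^ 2 * m)).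
{ apply (is_RInt_unique (V := R_CompleteNormedModule)).
  apply (is_RInt_ext (fun x => plus (scal (b ^ 2) ((p1 x - p2 x) * (z x * z x)))
                                    (scal c (scal (b ^ 2) (z x ^ 2))))).
  - rewrite Rmin_left, Rmax_right by lra; intros x Hx.
    assert (Ix : I01 x) by (unfold I01; lra).
    rewrite Eu, Hs by exact Ix; unfold plus, scal; simpl; unfold mult; simpl; ring.
  - apply (is_RInt_plus (V := R_NormedModule)).
    + apply (is_RInt_scal (fun x => (p1 x - p2 x) * (z x * z x))), HJ.
    + apply (is_RInt_scal (fun x => scal (b ^ 2) (z x ^ 2))), (is_RInt_scal (fun x => z x ^ 2)), Hm. }
assert (d0 : 0 <= d) by lra.
assert (B0 : 0 < B) by apply exp_pos.
assert (BJ : Rabs J <= 4 * B ^ 2 * d ^ 2).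
(* Subtracting the vanishing Green integral replaces one factor z by z - y, the second factor of
   order d. *)
{ replace J with (RInt (fun x => minus ((p1 x - p2 x) * (z x * z x)) ((p1 x - p2 x) * (y x * z x))) 0 1).
  2: { apply (is_RInt_unique (V := R_CompleteNormedModule)).
       evar_last; [apply (is_RInt_minus (V := R_NormedModule) _ _ 0 1 _ _ HJ HG)|].
       unfold minus, plus, opp; simpl; ring. }
  replace (4 * B ^ 2 * d ^ 2) with ((1 - 0) * (2 * d * (B * (2 * d) * B))) by ring.
  apply abs_RInt_le_const; [lra| |].
  - exists (minus J 0); apply (is_RInt_minus (V := R_NormedModule) _ _ 0 1 _ _ HJ HG).
  - intros x Hx.
    replace (minus ((p1 x - p2 x) * (z x * z x)) ((p1 x - p2 x) * (y x * z x)))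
      with ((p1 x - p2 x) * (- (y x - z x) * z x)) by (unfold minus, plus, opp; simpl; ring).
    rewrite !Rabs_mult, Rabs_Ropp.
    apply Rmult_le_compat; try apply Rabs_pos;
      [apply Rmult_le_pos; apply Rabs_pos|now apply Bpr|].
    apply Rmult_le_compat; try apply Rabs_pos.
    + apply (stability p1 p2 y _ z _ M (2 * d) Sq Sr Bp Br Bpr x Hx).
    + apply (solution_bound p2 z _ M Sr Br x Hx). }
rewrite HI, Hbm.
replace (c - (b ^ 2 * J + c * 1)) with (- (b ^ 2 * J)) by ring.
rewrite Rabs_Ropp, Rabs_mult, (Rabs_right (b ^ 2)) by (apply Rle_ge, pow2_ge_0).
(* Multiply 1 <= M^2 m by b^2 and use b^2 m = 1. *)
assert (Hb : b ^ 2 <= M ^ 2) by (pose proof (pow2_ge_0 b); nra).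
replace (4 * M ^ 2 * B ^ 2 * d ^ 2) with (M ^ 2 * (4 * B ^ 2 * d ^ 2)) by ring.
apply Rmult_le_compat; [apply pow2_ge_0|apply Rabs_pos|exact Hb|exact BJ].
Qed.

Theorem mainTheorem1 :
  exists C : R, 0 < C /\
    forall q qbar u : R -> R,
      classQ q -> classQ qbar -> is_normalized_ground_state qbar u ->
      Rabs (lambda q - lambda qbar
            - RInt (fun x => (q x - qbar x) * u x ^ 2) 0 1)
      <= C * norm_inf (fun x => q x - qbar x) ^ 2.
Proof.
exists (4 * (2 + PI ^ 2) ^ 2 * exp (3 + 2 * (2 + PI ^ 2)) ^ 2); split.
- pose proof (pow2_ge_0 PI).
  apply Rmult_lt_0_compat; [|apply pow_lt, exp_pos].
  apply Rmult_lt_0_compat; [lra|apply pow_lt; lra].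
- intros q r u Hq Hr Hu; apply classQ_admissible in Hq; apply classQ_admissible in Hr.
  apply lambda_expansion; try assumption.
  (* The bound 1 holds because both potentials take values in [0,1]. *)
  intros x Hx; apply (norm_inf_ge (fun x => q x - r x) 1); [|exact Hx].
  intros t Ht; destruct (Hq t Ht) as [[? ?] _]; destruct (Hr t Ht) as [[? ?] _].
  apply Rabs_le; lra.
Qed.
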